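(* For any positive integers $n$, $r$ and any integer $1 \le \ell \le n$, the following two identities hold: $$(1 + x + \cdots + x^{r-1})^n \, A_n (x) = G^{-,0}_{n,r}(x^r) + x \cdot \frac{G^{-,r-1}_{n,r}(x^r)}{x^r} + \cdots + x^{r-1} \cdot \frac{G^{-,1}_{n,r}(x^r)}{x^r},$$ $$(1+x+\cdots+x^{r-1})^n A_{n}^{\langle \ell\rangle}(x) = G^{\ell, 0}_{n,r}(x^r) + x \cdot \frac{G^{\ell, r-1}_{n,r}(x^r)}{x^r} + \cdots + x^{r-1} \cdot \frac{G^{\ell, 1}_{n,r}(x^r)}{x^r}.$$ (That is, the right-hand sides are $G^{-,0}_{n,r}(x^r)+\sum_{j=1}^{r-1}x^{j}\,G^{-,r-j}_{n,r}(x^r)/x^r$ and $G^{\ell,0}_{n,r}(x^r)+\sum_{j=1}^{r-1}x^{j}\,G^{\ell,r-j}_{n,r}(x^r)/x^r$ respectively.)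
   Context: Let $\mathfrak{S}_n$ be the set of permutations of $[n]=\{1,\ldots,n\}$. For $\pi\in\mathfrak{S}_n$, $\mathrm{des}(\pi)$ is the number of $i$ with $1\le i\le n-1$ and $\pi(i)>\pi(i+1)$. The Eulerian polynomial is $A_n(x)=\sum_{\pi\in\mathfrak{S}_n}x^{\mathrm{des}(\pi)}$ (equivalently, $\sum_{i\ge 0}(i+1)^n x^i=A_n(x)/(1-x)^{n+1}$), and for $1\le\ell\le n$, $$A_n^{\langle \ell \rangle}(x) = \sum_{\pi \in \mathfrak{S}_n,\ \pi(1)=\ell} x^{\mathrm{des}(\pi)}.$$ For a positive integer $r$, the elements of the wreath product $\mathbb{Z}_r \wr \mathfrak{S}_n$ are viewed as $r$-colored permutations, written $\pi = (\pi(1)_{\xi_1}, \ldots, \pi(n)_{\xi_n})$, where $(\pi(1), \ldots, \pi(n) ) \in \mathfrak{S}_n$ and $(\xi_1, \ldots, \xi_n) \in \{0,1,\ldots,r-1\}^n$. The descent number of such a $\pi$ is $$\mathrm{des}(\pi) = |\{i \in [n] : \xi_i > \xi_{i+1} \text{ or } (\xi_i = \xi_{i+1} \text{ and } \pi(i) > \pi(i+1))\}|,$$ with the convention $\pi(n+1)=n+1$, $\xi_{n+1}=0$. For integers $1\le\ell\le n$ and $0\le c\le r-1$, define $$G^{-, c}_{n,r}(x) = \sum_{\pi \in \mathbb{Z}_r \wr \mathfrak{S}_n,\ \xi_1=c} x^{\mathrm{des}(\pi)},\qquad G^{\ell, c}_{n,r}(x) = \sum_{\pi \in \mathbb{Z}_r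 \wr \mathfrak{S}_n,\ \pi(1) = \ell,\ \xi_1= c}x^{\mathrm{des}(\pi)}.$$ *)

(* Defs.v *)
From mathcomp Require Import all_boot all_order all_fingroup all_algebra.

Set Implicit Arguments.
Unset Strict Implicit.
Unset Printing Implicit Defensive.

Import GRing.Theory.

Local Open Scope ring_scope.

(* Positions and letters are numbered from 0: position i and letter v here
   stand for i + 1 and v + 1 in [n], so the convention pi(n+1) = n+1 reads
   [letter s n = n]. *)
Definition letter (n : nat) (s : 'S_n) (i : nat) : nat :=
  oapp (fun j : 'I_n => val (s j)) n (insub i).

Definition des (n : nat) (s : 'S_n) : nat :=
  #|[set i : 'I_n | (i.+1 < n)%N && (letter s i.+1 < letter s i)%N]|.

Definition eulerian (n : nat) : {poly int} := \sum_(s : 'S_n) 'X^(des s).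

(* The first letter l is counted from 1. *)
Definition eulerian_first (n l : nat) : {poly int} :=
  \sum_(s : 'S_n | (letter s 0).+1 == l) 'X^(des s).

(* The underlying set of the wreath product of Z_r by S_n. *)
Notation colored_perm n r := ('S_n * {ffun 'I_n -> 'I_r})%type.

(* Equal to 0 at position n, i.e. xi_{n+1} = 0. *)
Definition color (n r : nat) (p : colored_perm n r) (i : nat) : nat :=
  oapp (fun j : 'I_n => val (p.2 j)) 0%N (insub i).

Definition cdes (n r : nat) (p : colored_perm n r) : nat :=
  #|[set i : 'I_n | (color p i > color p i.+1)%N
       || (color p i == color p i.+1) && (letter p.1 i > letter p.1 i.+1)%N]|.

Definition G_color (n r c : nat) : {poly int} :=
  \sum_(p : colored_perm n r | color p 0 == c) 'X^(cdes p).

Definition G_first_color (n r l c : nat) : {poly int} :=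
  \sum_(p : colored_perm n r | ((letter p.1 0).+1 == l) && (color p 0 == c))
     'X^(cdes p).

(* Main.v *)
Require Import Defs.
From mathcomp Require Import all_boot all_order all_fingroup all_algebra.
From mathcomp Require Import zify.

Import GRing.Theory.

Local Open Scope ring_scope.

(** Since the x^(r-c) and 1/x^r in front of G^{-,c} and G^{l,c} combine to
x^(-c), the right-hand sides are the sums of x^(r des(pi) - xi_1) over the
colored permutations pi, all of them or those with first letter l.  It is
therefore enough to show, for each sigma in S_n separately, that
<<
  sum over colorings xi of sigma of x^(r des(sigma, xi) - xi_1)
    = (1 + x + ... + x^(r-1))^n x^(des sigma),
>>
and to sum over the relevant sigma.

As xi_(n+1) = 0, the exponent telescopes into
the sum over i of r [i is a descent of (sigma, xi)] - (xi_i - xi_(i+1)).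
Let d_i in {0, ..., r-1} be xi_(i+1) - xi_i modulo r.  If d_i is nonzero, the
i-th term is d_i, because an actual drop in color is compensated by the r that
the resulting descent contributes; if d_i = 0, the term is r or 0 according as
sigma(i) > sigma(i+1) or not ([weight_sub], [cdes_weight]).  So the i-th term
depends on xi only through d_i.  The coloring can be recovered from its
differences by going down from xi_(n+1) = 0 ([steps_inj]), so the d_i range
freely over Z_r and the sum factors ([sum_colors]).  The i-th factor is
1 + x + ... + x^(r-1) when sigma(i) < sigma(i+1), and x + ... + x^r when
sigma(i) > sigma(i+1) ([sum_weight]); the extra factors x count the descents
of sigma.

In the lemmas the number of colors has the form r.+1, which makes the type of
colors an additive group. *)

Definition descent {n : nat} (s : 'S_n) (i : nat) : bool :=
  (letter s i.+1 < letter s i)%N.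

(** The last position never counts: its next letter is the conventional n,
which is above all others. *)
Lemma des_sum (n : nat) (s : 'S_n) : des s = (\sum_(i < n) descent s i)%N.
Proof.
rewrite /des -sum1dep_card big_mkcond; apply: eq_bigr => i _.
rewrite -/(descent s i); have [lt_i_n | le_n_i] /= := ltnP i.+1 n.
  by case: (descent s i).
suff -> : descent s i = false by [].
by rewrite /descent /letter insubN -?leqNgt //= valK ltnNge /= ltnW ?ltn_ord.
Qed.

(** Same as [color], but with values in Z_(r+1), so that colors can be
subtracted. *)
Definition ext_color {n r : nat} (f : {ffun 'I_n -> 'I_r.+1}) (i : nat) :
  'I_r.+1 := oapp f 0 (insub i).

Lemma ext_colorE n r (f : {ffun 'I_n -> 'I_r.+1}) (i : 'I_n) :
  ext_color f i = f i.
Proof. by rewrite /ext_color valK. Qed.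

Lemma ext_color_end n r (f : {ffun 'I_n -> 'I_r.+1}) : ext_color f n = 0.
Proof. by rewrite /ext_color insubN // ltnn. Qed.

Lemma color_val n r (p : colored_perm n r.+1) i :
  color p i = ext_color p.2 i :> nat.
Proof. by rewrite /color /ext_color; case: insub. Qed.

Definition steps {n r : nat} (f : {ffun 'I_n -> 'I_r.+1}) :
  {ffun 'I_n -> 'I_r.+1} := [ffun i : 'I_n => ext_color f i.+1 - f i].

(** The differences determine the coloring because its value at n is fixed to
0: the colors are recovered from right to left. *)
Lemma steps_inj n r : injective (@steps n r).
Proof.
move=> f g eq_fg.
have eq_next k : (k <= n)%N -> ext_color f (n - k) = ext_color g (n - k).
  elim: k => [|k IHk] lt_k_n; first by rewrite subn0 !ext_color_end.
  have lt_i_n : (n - k.+1 < n)%N by lia.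
  have /ffunP/(_ (Ordinal lt_i_n)) := eq_fg; rewrite !ffunE -!ext_colorE /=.
  by rewrite -subSn // subSS IHk 1?ltnW // => /addrI/oppr_inj.
apply/ffunP=> i; rewrite -!ext_colorE.
by have := eq_next (n - i)%N (leq_subr _ _); rewrite subKn // ltnW.
Qed.

(** The contribution of a position to r des(pi) - xi_1, where D tells whether
the letters descend there and d is the difference of colors. *)
Definition weight {r : nat} (D : bool) (d : 'I_r.+1) : nat :=
  if d == 0 then (r.+1 * D)%N else d.

(** When b < a, the representative of b - a is r.+1 + b - a, and the r.+1 is
accounted for by the descent caused by the drop in color. *)
Lemma weight_sub {r} (D : bool) (a b : 'I_r.+1) :
  (weight D (b - a)%R + a = r.+1 * ((b < a) || (a == b :> nat) && D) + b)%N.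
Proof.
have [-> | neq_ab] := eqVneq a b.
  by rewrite /weight subrr !eqxx ltnn.
have neq_ab_nat : (a == b :> nat) = false by apply: negbTE.
rewrite /weight subr_eq0 eq_sym (negbTE neq_ab) neq_ab_nat orbF /=.
have [lt_a lt_b] := (ltn_ord a, ltn_ord b); rewrite modnDmr.
have [lt_ba | le_ab] := ltnP b a.
  by rewrite modn_small /=; lia.
have -> : (b + (r.+1 - a) = b - a + r.+1)%N by lia.
by rewrite modnDr modn_small; lia.
Qed.

(** Summing [weight_sub] over all positions: the colors cancel, except the
first one, since the last one is 0. *)
Lemma cdes_weight n r (s : 'S_n) (f : {ffun 'I_n -> 'I_r.+1}) :
  (\sum_(i < n) weight (descent s i) (steps f i) + color (s, f) 0
     = r.+1 * cdes (s, f))%N.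
Proof.
pose c := color (s, f).
have c_n : c n = 0%N by rewrite /c color_val ext_color_end.
have telescope : (c 0 + \sum_(i < n) c i.+1 = \sum_(i < n) c i)%N.
  have := @big_ord_recr _ 0%N addn n (fun i : 'I_n.+1 => c i).
  by rewrite big_ord_recl c_n /= addn0.
apply: (@addIn (\sum_(i < n) c i.+1)%N).
rewrite -addnA telescope -big_split /= /cdes -sum1dep_card.
rewrite [in RHS]big_mkcond big_distrr /= -big_split; apply: eq_bigr => i _ /=.
have := weight_sub (descent s i) (f i) (ext_color f i.+1).
rewrite ffunE /c !color_val /= ext_colorE /descent => ->.
by case: ifP.
Qed.

(** The zero difference contributes the bottom term 1 of the geometric sum
when D is false, and the top term of x times that sum when D is true. *)
Lemma sum_weight r (D : bool) :
  \sum_(d < r.+1) 'X^(weight D d) = 'X^D * \sum_(i < r.+1) 'X^i :> {poly int}.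
Proof.
rewrite big_ord_recl /weight eqxx.
under eq_bigr => i _ do rewrite -(inj_eq val_inj) /= /bump /= add1n.
case: D; last by rewrite muln0 mul1r [in RHS]big_ord_recl.
rewrite muln1 mulr_sumr big_ord_recr /= -exprS addrC.
by congr (_ + _); apply: eq_bigr => i _; rewrite -exprS.
Qed.

(** Changing variables from colors to differences makes the exponent a sum of
terms in independent variables, so that the sum becomes a product. *)
Lemma sum_colors n r (s : 'S_n) :
  \sum_(f : {ffun 'I_n -> 'I_r.+1}) 'X^(r.+1 * cdes (s, f) - color (s, f) 0)
    = (\sum_(i < r.+1) 'X^i) ^+ n * 'X^(des s) :> {poly int}.
Proof.
under eq_bigr => f _ do rewrite -cdes_weight addnK -prodrXr.
rewrite -(@reindex_inj _ _ _ _ steps xpredT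
  (fun g => \prod_(i < n) 'X^(weight (descent s i) (g i))) (@steps_inj n r)).
rewrite -(@bigA_distr_bigA _ _ _ _ _ _ _
  (fun (i : 'I_n) (d : 'I_r.+1) => 'X^(weight (descent s i) d))).
under eq_bigr => i _ do rewrite sum_weight.
by rewrite big_split /= prodrXr -des_sum prodr_const card_ord mulrC.
Qed.

(** The common form of both identities, for an arbitrary set P of
permutations: [sum_colors], added over P and sorted by first color. *)
Lemma fraction_identity n r (P : pred 'S_n) (G : nat -> {poly int}) :
    (forall c, G c = \sum_(p : colored_perm n r.+1 | P p.1 && (color p 0 == c))
                        'X^(cdes p)) ->
  tofrac ((\sum_(i < r.+1) 'X^i) ^+ n * \sum_(s | P s) 'X^(des s))
    = tofrac (G 0 \Po 'X^(r.+1))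
      + \sum_(1 <= j < r.+1)
          tofrac 'X^j
            * (tofrac (G (r.+1 - j)%N \Po 'X^(r.+1)) / tofrac 'X^(r.+1))
    :> {fraction {poly int}}.
Proof.
move=> defG.
pose F c : {poly int} := \sum_(p : colored_perm n r.+1
  | P p.1 && (color p 0 == c)) 'X^(r.+1 * cdes p - color p 0).
have G_subst c : G c \Po 'X^(r.+1) = 'X^c * F c.
  rewrite defG raddf_sum mulr_sumr.
  apply: eq_bigr => -[s f] /andP[_ /eqP <-] /=.
  rewrite comp_Xn_poly -exprM -exprD subnKC //.
  by rewrite -cdes_weight leq_addl.
have -> : (\sum_(i < r.+1) 'X^i) ^+ n * \sum_(s | P s) 'X^(des s)
            = \sum_(0 <= c < r.+1) F c :> {poly int}.
  rewrite mulr_sumr; under eq_bigr => s _ do rewrite -sum_colors.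
  rewrite pair_big /= big_mkord.
  rewrite (partition_big (fun p => ext_color p.2 0) xpredT) //=.
  apply: eq_bigr => c _; apply: eq_big => [p | [s f] _] //.
  by rewrite color_val andbT (inj_eq val_inj).
rewrite big_ltn // rmorphD G_subst mul1r; congr (_ + _).
(* The first color attached to x^j is c = r.+1 - j. *)
rewrite big_nat_rev rmorph_sum /=; apply: eq_big_nat => j /andP[_ lt_j_r].
rewrite add1n subSS G_subst mulrA -rmorphM mulrA -exprD subnKC 1?ltnW //.
by rewrite rmorphM mulrAC divff ?mul1r // tofrac_eq0 monic_neq0 ?monicXn.
Qed.

(* Both identities are stated in the fraction field of Z[x], where division
   by x^r is literal (tofrac embeds Z[x] into it); G \Po 'X^r is G(x^r). *)
Theorem theorem3p6 (n r l : nat) (n_gt0 : (0 < n)%N) (r_gt0 : (0 < r)%N)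
    (l_range : (1 <= l <= n)%N) :
  (tofrac ((\sum_(i < r) 'X^i) ^+ n * eulerian n)
     = tofrac (G_color n r 0 \Po 'X^r)
       + \sum_(1 <= j < r)
           tofrac 'X^j * (tofrac (G_color n r (r - j) \Po 'X^r) / tofrac 'X^r)
     :> {fraction {poly int}})
  /\
  (tofrac ((\sum_(i < r) 'X^i) ^+ n * eulerian_first n l)
     = tofrac (G_first_color n r l 0 \Po 'X^r)
       + \sum_(1 <= j < r)
           tofrac 'X^j * (tofrac (G_first_color n r l (r - j) \Po 'X^r) / tofrac 'X^r)
     :> {fraction {poly int}}).
Proof.
case: r r_gt0 => // r _; split.
  exact: (@fraction_identity n r xpredT (G_color n r.+1)).
exact: (@fraction_identity n r (fun s => (letter s 0).+1 == l)
  (G_first_color n r.+1 l)).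
Qed.
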